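(* Let $K$ be a field of positive characteristic, let $G\subset K^*$ be a finitely generated subgroup, let $$F(x)=\sum_{n\ge 0}a_nx^n$$ be a rational power series defined over $K$, and suppose that $a_n\in G\cup\{0\}$ for all $n\ge 0$. Then there are integers $M\ge 1$ and $N\ge 0$ such that $$F(x)=P(x)+\sum_{b=0}^{M-1}\frac{\mu_b x^{b+MN}}{1-\delta_b x^M},$$ where $P(x)$ is a polynomial of degree at most $MN-1$ with coefficients in $G\cup\{0\}$, $\delta_0,\ldots,\delta_{M-1}\in G$, and $\mu_0,\ldots,\mu_{M-1}\in G\cup\{0\}$.
   Context: A rational power series over $K$ is a formal power series in $K[[x]]$ that is the expansion at $0$ of a rational function in $K(x)$. $K^*$ is the multiplicative group of $K$. *)

(* Defs.v *)
From mathcomp Require Import all_boot all_order all_algebra.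
From mathcomp Require Import boolp classical_sets.

Set Implicit Arguments.
Unset Strict Implicit.
Unset Printing Implicit Defensive.

Import GRing.Theory.
Local Open Scope ring_scope.
Local Open Scope classical_set_scope.

Notation "x %:F" := (tofrac x) : ring_scope.

Definition units_subgroup (K : fieldType) (G : set K) : Prop :=
  [/\ forall x, G x -> x != 0,
      G 1 &
      forall x y, G x -> G y -> G (x / y)].

(* The first conjunct rules out the case 0 \in s, where [smallest] is an
   intersection over the empty family. *)
Definition fg_units_subgroup (K : fieldType) (G : set K) : Prop :=
  units_subgroup G /\
  exists s : seq K, G = smallest (@units_subgroup K) [set` s].

(* A formal power series \sum_n a_n x^n in K[[x]] is given by its coefficient
   sequence a : nat -> K, and K(x) is {fraction {poly K}}.  The sequence a is
   the expansion at 0 of f when f = P / Q with Q(0) != 0 and Q * a = P in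
   K[[x]] (Cauchy product). *)
Definition is_expansion (K : fieldType) (f : {fraction {poly K}})
    (a : nat -> K) : Prop :=
  exists P Q : {poly K},
    [/\ Q.[0] != 0,
        f = P%:F / Q%:F &
        forall n, \sum_(i < n.+1) Q`_i * a (n - i)%N = P`_n].

(* The expansion does not depend on the representation of f as P / Q. *)
Lemma is_expansion_uniq (K : fieldType) (f : {fraction {poly K}})
    (a b : nat -> K) : is_expansion f a -> is_expansion f b -> a =1 b.
Proof.
move=> [P1 [Q1 [Q1n0 -> Ha]]] [P2 [Q2 [Q2n0 eqf Hb]]] n.
have nz (Q : {poly K}) : Q.[0] != 0 -> Q%:F != 0.
  by rewrite tofrac_eq0; apply: contra_neq => ->; rewrite horner0.
have PQ : P1 * Q2 = P2 * Q1.
  apply/eqP; rewrite -tofrac_eq !tofracM -eqr_div ?nz //; exact/eqP.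
pose t c : {poly K} := \poly_(i < n.+1) c i.
pose low (R : {poly K}) := forall i, (i <= n)%N -> R`_i = 0.
have lowM (Q R : {poly K}) : low R -> low (Q * R).
  move=> lR i li; rewrite coefM big1 // => j _.
  by rewrite lR ?mulr0 // (leq_trans (leq_subr _ _)).
have lowt (Q P : {poly K}) (c : nat -> K) : (forall n, \sum_(i < n.+1) Q`_i * c (n - i)%N = P`_n) ->
    low (Q * t c - P).
  move=> H i li; rewrite coefB coefM -H -sumrB big1 // => j _.
  by rewrite coef_poly ltnS (leq_trans (leq_subr _ _) li) subrr.
have : low (Q1 * Q2 * (t a - t b)).
  have -> : Q1 * Q2 * (t a - t b)
          = Q2 * (Q1 * t a - P1) - Q1 * (Q2 * t b - P2).
    rewrite !mulrBr [Q2 * P1]mulrC PQ [P2 * Q1]mulrC !mulrA [Q2 * Q1]mulrC.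
    by rewrite opprD opprK addrACA [_ + Q1 * P2]addrC subrr addr0.
  move=> i li; rewrite coefB (lowM _ _ (lowt _ _ _ Ha) i li).
  by rewrite (lowM _ _ (lowt _ _ _ Hb) i li) subrr.
set Q := Q1 * Q2; set D := t a - t b => lowQD.
have Q0 : Q`_0 != 0 by rewrite -horner_coef0 hornerM mulf_neq0.
have lowD : low D.
  elim/ltn_ind=> i IH li; have := lowQD i li.
  rewrite coefM big_ord_recl /= subn0 big1 ?addr0 => [|j _].
    by move/eqP; rewrite mulf_eq0 (negPf Q0) => /eqP.
  have lt : (i - bump 0 j < i)%N.
    by rewrite ltn_subrL /= (leq_ltn_trans _ (ltn_ord j)).
  by rewrite IH ?mulr0 // (leq_trans (ltnW lt)).
by have /eqP := lowD n (leqnn n); rewrite coefB !coef_poly ltnSn subr_eq0 => /eqP.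
Qed.

Definition rational_series (K : fieldType) (a : nat -> K) : Prop :=
  exists f : {fraction {poly K}}, is_expansion f a.

(* Main.v *)
(* Over a splitting field, and after restricting to the residue classes modulo
   a suitable M (divisible by a large power of p to make the roots simple), the
   sequence is a power sum u(m) = \sum_i c_i t_i^m in which no quotient
   t_i / t_j, i <> j, is a root of unity; one shows that at most one term is
   present.  Let E be a field containing G, the c_i and the t_i, and q = p^k.
   Since G / G^q is finite, the values u(r + q m) = \sum_i (c_i t_i^r) (t_i^m)^q
   lie in finitely many lines E^q g.  If the c_i t_i^r were not all in one such
   line, each line would impose a nontrivial linear relation on the vector
   (t_i^m)_i, and the product of these finitely many power sums would vanish
   identically; this is impossible, by comparing dominant terms for a total
   order on the group of the t_i modulo torsion.  Taking r = 0 and r = 1, every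
   t_i / t_j is a q-th power in E, for every k.  But E can be taken finite over
   a field A(x) with x = t_i / t_j transcendental over A, in which x has no
   p^k-th root once p^k exceeds the degree. *)

Require Import Defs.
From HB Require Import structures.
From mathcomp Require Import all_boot all_order all_algebra.
From mathcomp Require Import fieldext finfield.
From mathcomp Require Import boolp classical_sets.
From mathcomp Require Import ring.

Set Implicit Arguments.
Unset Strict Implicit.
Unset Printing Implicit Defensive.

Import GRing.Theory.
Local Open Scope ring_scope.
Local Open Scope classical_set_scope.

(** * Products of power sums *)

(* Pitfall: [nontorsion 0] holds; non-vanishing is always assumed separately. *)
Definition nontorsion (K : fieldType) (x : K) : Prop :=
  forall n, x ^+ n.+1 != 1.

(* [P] is the positive cone of a total order on K^* modulo torsion; it is a
   maximal multiplicative semigroup without roots of unity. *)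
Lemma nontorsion_cone (K : fieldType) :
  exists P : set K,
    [/\ forall x y, P x -> P y -> P (x * y),
        forall x, P x -> nontorsion x &
        forall x, x != 0 -> nontorsion x -> P x \/ P x^-1].
Proof.
pose good (P : set K) :=
  (forall x y, P x -> P y -> P (x * y)) /\
  (forall x, P x -> x != 0 /\ nontorsion x).
have [P [[PM Pnr] Pmax]] : exists P, good P /\ forall Q, P `<` Q -> ~ good Q.
  apply: Zorn_bigcup => F Fgood Ftot; split=> [x y [X FX Xx] [Y FY Yy]|x [X FX]].
    have [XY|YX] := Ftot X Y FX FY.
      by exists Y => //; apply: (Fgood Y FY).1 => //; apply: XY.
    by exists X => //; apply: (Fgood X FX).1 => //; apply: YX.
  exact: (Fgood X FX).2.
exists P; split=> // [x /Pnr[] //|x x0 nrx].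
have PX n z : P z -> P (z ^+ n.+1).
  by move=> Pz; elim: n => // n IH; rewrite exprS; apply: PM.
(* By maximality the semigroup generated by [P] and [z] contains a root of unity, hence some
   [y * z ^+ n.+1] with [y] in [P], unless a power of [z^-1] is already in [P]; a power of that
   product equal to 1 again puts a power of [z^-1] in [P]. *)
have key z : z != 0 -> nontorsion z -> ~ P z -> exists n, P (z^-1 ^+ n.+1).
  move=> z0 nrz Pz.
  pose Q := [set t | P t \/ exists n,
    t = z ^+ n.+1 \/ exists2 y, P y & t = y * z ^+ n.+1].
  have PQ : P `<` Q.
    split=> [t Pt|QP]; first by left.
    by apply: Pz; apply: QP; right; exists 0%N; left.
  have {}PQ := Pmax _ PQ; apply: contrapT => nP; apply: PQ; split.
    move=> s t [Ps|[n Hs]] [Pt|[m Ht]].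
    - by left; apply: PM.
    - right; exists m; right; case: Ht => [->|[y Py ->]]; first by exists s.
      by exists (s * y); [apply: PM|rewrite mulrA].
    - right; exists n; right; case: Hs => [->|[y Py ->]].
        by exists t => //; rewrite mulrC.
      by exists (t * y); [apply: PM|rewrite mulrC mulrA].
    - right; exists (n + m).+1; rewrite -addSn -addnS exprD.
      case: Hs Ht => [->|[y Py ->]] [->|[y' Py' ->]].
      + by left.
      + by right; exists y' => //; rewrite mulrCA.
      + by right; exists y => //; rewrite mulrA.
      + by right; exists (y * y'); [apply: PM|rewrite mulrACA].
  move=> t [/Pnr //|[n [->|[y Py ->]]]].
    by split=> [|m]; [rewrite expf_neq0|rewrite -exprM mulnS addSn].
  have [y0 nry] := Pnr _ Py.
  split=> [|m]; first by rewrite mulf_neq0 // expf_neq0.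
  apply/eqP => e; apply: nP; exists (n * m.+1 + m)%N.
  have -> : z^-1 ^+ (n * m.+1 + m).+1 = y ^+ m.+1.
    apply: (mulIf (expf_neq0 (n * m.+1 + m).+1 z0)).
    rewrite -exprMn mulVf // expr1n.
    by rewrite -addnS addnC -mulSn exprM -exprMn e.
  exact: PX.
have [Px|nPx] := pselect (P x); first by left.
have [Pv|nPv] := pselect (P x^-1); first by right.
have [n Pn] := key x x0 nrx nPx.
have nrv : nontorsion x^-1.
  by move=> m; rewrite exprVn invr_eq1.
have [m Pm] := key x^-1 (invr_neq0 x0) nrv nPv.
(* A power of [x^-1] and a power of [x] both lie in [P]; raised to a common exponent they multiply
   to 1, which is torsion. *)
have := PM _ _ (PX m _ Pn) (PX n _ Pm).
rewrite invrK -!exprM [in X in _ * X]mulnC -exprMn mulVf // expr1n.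
by case/Pnr => _ /(_ 0%N); rewrite expr1n eqxx.
Qed.

Section PowerSums.
Variable K : fieldType.

(** Induction on [s]: subtracting [d j] times the relation at [m] from the one at [m.+1] removes the
    term [j] and multiplies [x] by [e - d j], which is nonzero. The other bases may repeat. *)
Lemma geometric_term_eq0 (I : eqType) (s : seq I) (c d : I -> K) (x e : K) :
  (forall i, i \in s -> d i != e) ->
  (forall m, x * e ^+ m + \sum_(i <- s) c i * d i ^+ m = 0) -> x = 0.
Proof.
elim: s c x => [|j s IH] c x de H.
  by have := H 0%N; rewrite big_nil addr0 mulr1.
suff : x * (e - d j) = 0.
  move/eqP; rewrite mulf_eq0 subr_eq0 => /orP[/eqP//|/eqP ee].
  by have := de j (mem_head _ _); rewrite ee eqxx.
apply: (IH (fun i => c i * (d i - d j))) => [i si|m].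
  by apply: de; rewrite inE si orbT.
have -> : \sum_(i <- s) c i * (d i - d j) * d i ^+ m
  = \sum_(i <- s) c i * d i ^+ m.+1 - d j * \sum_(i <- s) c i * d i ^+ m.
  rewrite big_distrr -sumrB; apply: eq_bigr => i _ /=.
  by rewrite exprS; ring.
have := H m.+1; have := H m; rewrite !big_cons.
set A := \sum_(_ <- _) _; set B := \sum_(_ <- _) _ => Hm HS.
rewrite -[RHS](subr0 0) -{1}HS -(mulr0 (d j)) -Hm !exprS.
by ring.
Qed.

Variable P : set K.
Hypothesis PM : forall x y, P x -> P y -> P (x * y).
Hypothesis Pnr : forall x, P x -> nontorsion x.
Hypothesis Ptot : forall x, x != 0 -> nontorsion x -> P x \/ P x^-1.

(* [e] dominates for the order [x < y := P (y / x)]. *)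
Definition has_lead (h : nat -> K) (e : K) : Prop :=
  e != 0 /\ exists x (s : seq (K * K)),
    [/\ x != 0, forall z, z \in s -> P (e / z.2) &
        forall m, h m = x * e ^+ m + \sum_(z <- s) z.1 * z.2 ^+ m].

Lemma has_lead_neq0 h e : has_lead h e -> exists m, h m != 0.
Proof.
move=> [e0 [x [s [x0 sP hE]]]]; apply: contrapT => /forallNP h0.
case/eqP: x0; apply: (@geometric_term_eq0 _ s fst snd x e) => [z zs|m].
  apply/eqP => ze; have /Pnr/(_ 0%N) := sP z zs.
  by rewrite ze divff // expr1n eqxx.
by rewrite -hE; have /negP := h0 m; rewrite negbK => /eqP.
Qed.

Lemma has_leadM h e h' e' :
  has_lead h e -> has_lead h' e' -> has_lead (fun m => h m * h' m) (e * e').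
Proof.
move=> [e0 [x [s [x0 sP hE]]]] [e0' [x' [s' [x0' sP' hE']]]].
split; first by rewrite mulf_neq0.
exists (x * x'), ([seq (x * z.1, e * z.2) | z <- s'] ++
  [seq (z.1 * x', z.2 * e') | z <- s] ++
  [seq (z.1 * z'.1, z.2 * z'.2) | z <- s, z' <- s']).
split=> [|z|m]; first by rewrite mulf_neq0.
  rewrite !mem_cat.
  case/or3P=> [/mapP[y ys ->]|/mapP[y ys ->]|/allpairsP[[y y'] [ys ys' ->]]] /=.
  - by rewrite -mulf_div divff // mul1r; apply: sP'.
  - by rewrite -mulf_div divff // mulr1; apply: sP.
  - by rewrite -mulf_div; apply: PM; [apply: sP|apply: sP'].
rewrite hE hE' mulrDl !mulrDr exprMn !big_cat /= !big_map -!addrA.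
congr +%R; first by rewrite mulrACA.
congr +%R.
  by rewrite big_distrr; apply: eq_bigr => z _; rewrite /= exprMn mulrACA.
congr +%R.
  by rewrite big_distrl; apply: eq_bigr => z _; rewrite /= exprMn mulrACA.
rewrite big_distrlr /= big_allpairs_dep /=; apply: eq_bigr => z _.
by apply: eq_bigr => z' _; rewrite exprMn mulrACA.
Qed.

(** A term with nonzero coefficient is compared with the current leading one; the nontorsion ratio
    makes the two bases comparable, and transitivity carries the old dominated terms along. *)
Lemma power_sum_lead (I : eqType) (s : seq I) (c d : I -> K) :
  uniq s -> (forall i, d i != 0) ->
  (forall i j, i != j -> nontorsion (d i / d j)) ->
  {in s, forall i, c i = 0} \/
  exists2 i, i \in s & has_lead (fun m => \sum_(i <- s) c i * d i ^+ m) (d i).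
Proof.
move=> + d0 dnr; elim: s => [_|j s IH /= /andP[js us]]; first by left.
have [cj0|cj0] := eqVneq (c j) 0.
  have [s0|[i si Hi]] := IH us; [left=> k|right; exists i].
  - by rewrite inE => /orP[/eqP->//|]; apply: s0.
  - by rewrite inE si orbT.
  - move: Hi; congr (has_lead _ _); apply: funext => m.
    by rewrite big_cons cj0 mul0r add0r.
right; have [s0|[i si [_ [x [t [x0 tP tE]]]]]] := IH us.
  exists j; first by rewrite mem_head.
  split=> //; exists (c j), [::]; split=> // m.
  by rewrite big_cons big_nil big_seq big1 // => i /s0->; rewrite mul0r.
have nij : i != j by apply: contraNneq js => <-.
have [Pij|Pji] := Ptot (mulf_neq0 (d0 i) (invr_neq0 (d0 j))) (dnr _ _ nij).
  exists i; first by rewrite inE si orbT.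
  split=> //; exists x, ((c j, d j) :: t); split=> // [z|m].
    by rewrite inE => /orP[/eqP->//|]; apply: tP.
  by rewrite !big_cons tE /= addrCA.
rewrite invf_div in Pji.
exists j; first by rewrite mem_head.
split=> //; exists (c j), ((x, d i) :: t); split=> // [z|m].
  rewrite inE => /orP[/eqP->//|/tP Pz].
  by have := PM Pji Pz; rewrite mulrA divfK.
by rewrite !big_cons tE.
Qed.

End PowerSums.

(** Leading terms multiply, so the product over [F] has a leading term and is nonzero at some [m],
    where no factor vanishes. *)
Lemma prod_power_sums_neq0 (K : fieldType) (F I : finType) (c : F -> I -> K)
    (d : I -> K) :
  (forall i, d i != 0) -> (forall i j, i != j -> nontorsion (d i / d j)) ->
  (forall f, exists i, c f i != 0) ->
  exists m, forall f, \sum_i c f i * d i ^+ m != 0.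
Proof.
move=> d0 dnr c0; have [P [PM Pnr Ptot]] := nontorsion_cone K.
suff: exists e, has_lead P (fun m => \prod_f \sum_i c f i * d i ^+ m) e.
  move=> [e /(has_lead_neq0 Pnr)[m hm]]; exists m => f.
  by move/prodf_neq0: hm; apply.
elim: (index_enum F) => [|f s [e IH]].
  exists 1; split; first exact: oner_neq0.
  exists 1, [::]; split=> [|//|m]; first exact: oner_neq0.
  by rewrite !big_nil expr1n mulr1 addr0.
have [s0|[i _ Hi]] := power_sum_lead PM Ptot (c f) (index_enum_uniq I) d0 dnr.
  by have [i /eqP[]] := c0 f; apply: s0; apply: mem_index_enum.
exists (d i * e).
have := has_leadM PM Hi IH; congr (has_lead _ _ _); apply: funext => m.
by rewrite big_cons.
Qed.

(** * Power sums and p-th powers *)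

Lemma exprD_pchar_pow (R : comNzRingType) p (charR : p \in [pchar R]) k (x y : R) :
  (x + y) ^+ (p ^ k) = x ^+ (p ^ k) + y ^+ (p ^ k).
Proof.
by apply: exprDn_pchar; rewrite pnatX pnatE ?charR // (pcharf_prime charR).
Qed.

Lemma sum_expr_pchar_pow (R : comNzRingType) p (charR : p \in [pchar R]) k
    (I : Type) (s : seq I) (F : I -> R) :
  (\sum_(i <- s) F i) ^+ (p ^ k) = \sum_(i <- s) F i ^+ (p ^ k).
Proof.
apply: (big_morph (fun x => x ^+ (p ^ k)) (exprD_pchar_pow charR k)).
by rewrite expr0n gtn_eqF // expn_gt0 prime_gt0 // (pcharf_prime charR).
Qed.

Lemma proper_subspace_functional (K : fieldType) r (W : set 'rV[K]_r)
    (v : 'rV[K]_r) :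
  W 0 -> (forall a x y, W x -> W y -> W (a *: x + y)) -> ~ W v ->
  exists phi : 'I_r -> K, (exists i, phi i != 0) /\
    forall x, W x -> \sum_i phi i * x 0 i = 0.
Proof.
move=> W0 Wlin nWv.
have Wsub (A : 'M[K]_r) : (forall i, W (row i A)) ->
    forall u : 'rV_r, (u <= A)%MS -> W u.
  move=> WA u /submxP[D ->]; rewrite mulmx_sum_row.
  elim: (index_enum _) => [|i s IH]; first by rewrite big_nil.
  by rewrite big_cons; apply: Wlin.
(* The subspace [W] is realized as the row space of a square matrix with rows in [W] and maximal
   rank; a column of its cokernel that does not kill [v] is the functional. *)
pose Q n := `[< exists2 A : 'M[K]_r, (forall i, W (row i A)) & \rank A = n >].
have Q0 : exists n, Q n.
  by exists 0%N; apply/asboolP; exists 0 => [i|]; rewrite ?row0 ?mxrank0.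
have Qle n : Q n -> (n <= r)%N by move/asboolP=> [A _ <-]; apply: rank_leq_row.
case: (ex_maxnP Q0 Qle) => n /asboolP[A WA rA] nmax.
have WleA w : W w -> (w <= A)%MS.
  move=> Ww; apply: contrapT => /negP wA.
  have rlt : (n < \rank (w + A)%MS)%N.
    rewrite -rA ltn_neqAle mxrankS ?addsmxSr // andbT.
    apply: contra wA; rewrite mxrank_leqif_sup ?addsmxSr //.
    by rewrite addsmx_sub => /andP[].
  suff /nmax : Q (\rank (w + A)%MS) by rewrite leqNgt rlt.
  apply/asboolP; exists (w + A)%MS => // i.
  have /sub_addsmxP[[u1 u2] /= ->] : (row i (w + A)%MS <= w + A)%MS.
    exact: row_sub.
  rewrite [u1]mx11_scalar mul_scalar_mx; apply: Wlin => //.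
  by apply: Wsub WA _ (submxMl _ _).
have /rV0Pn[k vk] : v *m cokermx A != 0.
  by rewrite -submxE; apply/negP => vA; apply: nWv; apply: Wsub WA _ vA.
exists (fun i => cokermx A i k); split=> [|x /WleA].
  apply: contrapT => /forallNP k0; move: vk; rewrite mxE big1 ?eqxx // => i _.
  by have /negP/negPn/eqP-> := k0 i; rewrite mulr0.
by rewrite submxE => /eqP/matrixP/(_ 0 k); rewrite !mxE;
  under eq_bigr do rewrite mulrC.
Qed.

(** Exponents are reduced modulo [q]: only finitely many classes modulo [q]-th powers occur, indexed
    by [f]. *)
Lemma prod_exprz_mod (K : fieldType) n (s : 'I_n -> K) q (z : 'I_n -> int) :
  (0 < q)%N -> (forall i, s i != 0) ->
  exists (f : {ffun 'I_n -> 'I_q}) (y : K),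
    \prod_i s i ^ z i = y ^+ q * \prod_i s i ^+ f i.
Proof.
case: q => // q _ s0.
have zmod i : (0 <= (z i %% q.+1)%Z)%R by rewrite modz_ge0.
exists [ffun i => inord `|(z i %% q.+1)%Z|%N], (\prod_i s i ^ (z i %/ q.+1)%Z).
rewrite -prodrXl -big_split; apply: eq_bigr => i _ /=.
rewrite ffunE inordK; last first.
  by rewrite -ltz_nat gez0_abs // ltz_pmod.
rewrite [s i ^+ absz _]exprnP gez0_abs // exprnP exprz_exp -expfzDr //.
by rewrite -divz_eq.
Qed.

Lemma base_ratio_pth_power (E : fieldType) p (charE : p \in [pchar E])
    r (c d : 'I_r -> E) n (s : 'I_n -> E) :
  (forall i, c i != 0) -> (forall i, d i != 0) ->
  (forall i j, i != j -> nontorsion (d i / d j)) -> (forall i, s i != 0) ->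
  (forall m, let u := \sum_i c i * d i ^+ m in
    u = 0 \/ exists z : 'I_n -> int, u = \prod_i s i ^ z i) ->
  forall k i j, exists y, d i / d j = y ^+ (p ^ k).
Proof.
move=> c0 d0 dnr s0 Hu k i j; set q := (p ^ k)%N.
have q_gt0 : (0 < q)%N by rewrite expn_gt0 prime_gt0 // (pcharf_prime charE).
have exprDq := exprD_pchar_pow charE k.
have zeroq : 0 ^+ q = 0 :> E by rewrite expr0n gtn_eqF.
have common t : exists g : E, g != 0 /\
    forall i, exists y, c i * d i ^+ t = y ^+ q * g.
  pose g (f : {ffun 'I_n -> 'I_q}) := \prod_i s i ^+ f i.
  pose e i := c i * d i ^+ t.
  apply: contrapT => nG.
  have {nG} ne f : exists i, forall y, e i <> y ^+ q * g f.
    apply: contrapT => /forallNP H; apply: nG; exists (g f); split.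
      by apply/prodf_neq0 => l _; rewrite expf_neq0.
    by move=> l; apply: contrapT => /forallNP Hl; apply: (H l).
  (* [W f] is an [E]-linear subspace because the [q]-th power map is additive. It is proper: the
     unit vector at an index [l] whose [e l] is off the line of [g f] is not in it. *)
  pose W f (x : 'rV[E]_r) := exists y, \sum_i x 0 i ^+ q * e i = y ^+ q * g f.
  have phiP f : exists phi : 'I_r -> E, (exists i, phi i != 0) /\
      forall x, W f x -> \sum_i phi i * x 0 i = 0.
    have [l nel] := ne f.
    apply: (@proper_subspace_functional _ _ _ (delta_mx 0 l)).
    - by exists 0; rewrite zeroq mul0r big1 // => h _; rewrite mxE zeroq mul0r.
    - move=> a x x' [y Hy] [y' Hy']; exists (a * y + y').
      rewrite exprDq exprMn mulrDl -mulrA -Hy -Hy' big_distrr -big_split /=.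
      by apply: eq_bigr => h _; rewrite !mxE exprDq exprMn mulrDl mulrA.
    - move=> [y Hy]; apply: (nel y); rewrite -Hy (bigD1 l) //= mxE !eqxx expr1n.
      rewrite mul1r big1 ?addr0 // => h /negPf hl.
      by rewrite mxE hl andbF zeroq mul0r.
  have [phi Hphi] := choice phiP.
  (* The vector of the [d i ^+ m] avoids the hyperplanes of all [phi f], yet the value of the power
     sum at [t + m * q] puts it in one of the [W f]. *)
  have [m Hm] := prod_power_sums_neq0 d0 dnr (fun f => (Hphi f).1).
  have uE : \sum_i c i * d i ^+ (t + m * q) = \sum_i (d i ^+ m) ^+ q * e i.
    by apply: eq_bigr => l _; rewrite exprD exprM mulrA mulrC.
  have [f [y Hy]] : exists f y, \sum_i (d i ^+ m) ^+ q * e i = y ^+ q * g f.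
    case: (Hu (t + m * q)%N) => [|[z]]; rewrite uE => ->.
      (* Zero lies on every line, so any [f] serves. *)
      by exists [ffun=> Ordinal q_gt0], 0; rewrite zeroq mul0r.
    exact: prod_exprz_mod.
  have /eqP[] := Hm f.
  have := (Hphi f).2 (\row_i d i ^+ m).
  under eq_bigr do rewrite mxE; apply; exists y; rewrite -Hy.
  by under eq_bigr do rewrite mxE.
have [g0 [g0n0 Hg0]] := common 0%N; have [g1 [g1n0 Hg1]] := common 1%N.
have [y0 y0E] := Hg0 i; have [y0' y0E'] := Hg0 j.
have [y1 y1E] := Hg1 i; have [y1' y1E'] := Hg1 j.
rewrite !expr0 !mulr1 in y0E y0E'; rewrite !expr1 in y1E y1E'.
have ny0 : y0 ^+ q != 0 by have := c0 i; rewrite y0E mulf_eq0 negb_or => /andP[].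
have ny0' : y0' ^+ q != 0 by have := c0 j; rewrite y0E' mulf_eq0 negb_or => /andP[].
(* Each [d i] is the quotient of [c i * d i] by [c i], that is of [y1 ^+ q * g1] by [y0 ^+ q * g0];
   the factors [g0] and [g1] cancel in the ratio. *)
exists (y1 / y1' * (y0' / y0)).
have -> : d i = y1 ^+ q * g1 / c i by rewrite -y1E mulrC mulKf.
have -> : d j = y1' ^+ q * g1 / c j by rewrite -y1E' mulrC mulKf.
rewrite y0E y0E' !exprMn !exprVn.
have ny1' : y1' ^+ q != 0.
  by have := mulf_neq0 (c0 j) (d0 j); rewrite y1E' mulf_eq0 negb_or => /andP[].
by field; rewrite ny0 ny0' ny1' g0n0.
Qed.

(** * Fields finite over a purely transcendental extension *)

Lemma fractionP (A : idomainType) (x : {fraction A}) :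
  exists a b : A, b != 0 /\ x = a%:F / b%:F.
Proof.
elim/quotW: x => x; exists \n_x, \d_x; split; first exact: denom_ratioP.
apply: (mulIf (x := (\d_x)%:F)); first by rewrite tofrac_eq0 denom_ratioP.
rewrite divfK ?tofrac_eq0 ?denom_ratioP //.
unlock FracField.tofrac; rewrite -[X in X = _]FracField.pi_mul.
apply/eqmodP => /=; rewrite FracField.equivfE.
rewrite /FracField.mulf !numden_Ratio ?oner_neq0 ?mulf_neq0 ?denom_ratioP ?oner_neq0 //.
by rewrite !mulr1 mulrC.
Qed.

Lemma fraction_lift (A : idomainType) (L : fieldType) (i : {rmorphism A -> L}) :
  injective i -> exists f : {rmorphism {fraction A} -> L}, forall a, f a%:F = i a.
Proof.
move=> inj_i.
have i0 a : (i a == 0) = (a == 0) by rewrite -(rmorph0 i) (inj_eq inj_i).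
(* Quantifying over all presentations of [x] makes the chosen value computable from any of them. *)
have fP (x : {fraction A}) : exists y : L,
    forall a b, b != 0 -> x = a%:F / b%:F -> y = i a / i b.
  have [a [b [b0 ->]]] := fractionP x; exists (i a / i b) => a' b' b0' /eqP.
  rewrite eqr_div ?tofrac_eq0 // -!rmorphM /= tofrac_eq => /eqP e.
  by apply/eqP; rewrite eqr_div ?i0 // -!rmorphM e.
have [f Hf] := choice fP.
have fE a b : b != 0 -> f (a%:F / b%:F) = i a / i b by move=> b0; apply: Hf.
have fzmod : zmod_morphism f.
  move=> x y; have [a [b [b0 ->]]] := fractionP x.
  have [c [d [d0 ->]]] := fractionP y.
  rewrite -mulNr addf_div ?tofrac_eq0 // -rmorphN -!rmorphM -rmorphD /=.
  rewrite !fE ?mulf_neq0 // rmorphD !rmorphM rmorphN /=.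
  by rewrite -addf_div ?i0 // mulNr.
have fmon : monoid_morphism f.
  split=> [|x y].
    by rewrite -[X in f X]divr1 -tofrac1 fE ?oner_neq0 // rmorph1 divr1.
  have [a [b [b0 ->]]] := fractionP x.
  have [c [d [d0 ->]]] := fractionP y.
  by rewrite mulf_div -!rmorphM /= !fE ?mulf_neq0 // !rmorphM mulf_div.
pose fA := GRing.isZmodMorphism.Build _ _ f fzmod.
pose fM := GRing.isMonoidMorphism.Build _ _ f fmon.
pose g : {rmorphism {fraction A} -> L} := HB.pack f fA fM.
exists g => a; rewrite /= -[a%:F]divr1 -tofrac1 fE ?oner_neq0 //.
by rewrite rmorph1 divr1.
Qed.

(** Constant [P] are included, so [i] is injective as well. Allowing a ring for [A] lets variables
    be adjoined without forming fractions. *)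
Definition transcendental (A : nzRingType) (L : fieldType) (i : {rmorphism A -> L})
    (x : L) : Prop :=
  forall P : {poly A}, P != 0 -> (map_poly i P).[x] != 0.

(** If [P] vanished at [x], every power of [x] would be the value at [x] of a residue modulo [P];
    there are finitely many residues over a finite field, so two powers of [x] would agree. *)
Lemma nontorsion_transcendental_Fp (L : fieldType) p (charL : p \in [pchar L])
    (x : L) : x != 0 -> nontorsion x ->
  exists i : {rmorphism 'F_p -> L}, transcendental i x.
Proof.
move=> x0 nrx.
have i : {rmorphism 'F_p -> L} :=
  (in_alg (pPrimeCharType charL) : {rmorphism 'F_p -> pPrimeCharType charL}).
exists i => P P0; apply/negP => /eqP Px.
pose n := (size P).
pose r (k : nat) : 'rV['F_p]_n := poly_rV ('X^k %% P).
have rx k : (map_poly i (rVpoly (r k))).[x] = x ^+ k.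
  rewrite /r poly_rV_K; last by rewrite ltnW // ltn_modp.
  have := congr1 (fun Q => (map_poly i Q).[x]) (divp_eq 'X^k P).
  rewrite rmorphD rmorphM /= hornerD hornerM Px mulr0 add0r => <-.
  by rewrite map_polyXn hornerXn.
pose s (k : 'I_(#|{: 'rV['F_p]_n}|.+1)) := r k.
have /injectivePn[k [l kl /(congr1 (fun v => (map_poly i (rVpoly v)).[x]))]] :
    ~~ injectiveb s.
  apply/injectiveP => /leq_card; rewrite card_ord.
  by rewrite ltnn.
rewrite /s !rx.
wlog lt_kl : k l kl / (k < l)%N.
  move=> W; case: (ltngtP k l) => [|lt e|/ord_inj kl'].
  - exact: W.
  - by apply: (W l k) => //; rewrite eq_sym.
  - by rewrite kl' eqxx in kl.
rewrite -(subnK lt_kl) addnS -addSn exprD => /esym/eqP.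
rewrite -subr_eq0 -[X in _ - X]mul1r -mulrBl mulf_eq0 expf_eq0 (negPf x0) andbF.
by rewrite orbF subr_eq0 (negPf (nrx _)).
Qed.

Lemma horner2_map_eval (L : comNzRingType) (U : {poly {poly L}}) (x z : L) :
  U.[z%:P].[x] = (map_poly (horner_eval x) U).[z].
Proof. by rewrite -[LHS]/(horner_eval x _) -horner_map /= /horner_eval hornerC. Qed.

(* With the outer variable of R standing for z and the inner one for x, R says
   that z is algebraic over A[x]. *)
Lemma transcendence_base (L : fieldType) p (charL : p \in [pchar L]) (x : L)
    (s : seq L) : x != 0 -> nontorsion x ->
  exists (A : idomainType) (i : {rmorphism A -> L}), transcendental i x /\
    forall z, z \in s -> exists2 R : {poly {poly A}},
      R != 0 & (map_poly (map_poly i) R).[z%:P].[x] = 0.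
Proof.
move=> x0 nrx; elim: s => [|z s [A [i [tr IH]]]].
  have [i tr] := nontorsion_transcendental_Fp charL x0 nrx.
  by exists 'F_p, i.
have [[R R0 Rz]|nR] := pselect (exists2 R : {poly {poly A}},
      R != 0 & (map_poly (map_poly i) R).[z%:P].[x] = 0).
  exists A, i; split=> // z'; rewrite inE => /orP[/eqP->|/IH//].
  by exists R.
pose i' : {rmorphism {poly A} -> L} := horner_eval z \o map_poly i.
exists {poly A}, i'; split.
  (* Here [z] is not algebraic over A[x], and [A] is enlarged to A[z]. A relation for [x] over A[z]
     would become, with the variables swapped, one for [z] over A[x]. *)
  move=> P P0; apply/eqP => Px; apply: nR; exists (swapXY P).
    by rewrite swapXY_eq0.
  by rewrite -swapXY_map horner2_swapXY horner2_map_eval -map_poly_comp.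
move=> z'; rewrite inE => /orP[/eqP->|/IH[R R0 Rz]].
  (* The innermost variable is sent to [z], so [z] is a root of the outer variable minus it. *)
  exists ('X - ('X%:P)%:P); first by rewrite -size_poly_eq0 size_XsubC.
  rewrite rmorphB /= map_polyX !map_polyC /= map_polyC /= map_polyX.
  by rewrite /horner_eval hornerX !hornerE subrr.
exists (map_poly (map_poly polyC) R).
  rewrite -(map_poly0 (map_poly polyC)); apply: contra R0 => /eqP/map_inj_poly e.
  apply/eqP/e; last exact: rmorph0.
  by apply: map_inj_poly; [exact: polyC_inj|exact: rmorph0].
rewrite -[RHS]Rz -map_poly_comp; congr ((_.[_]).[_]); apply: eq_map_poly => Q /=.
rewrite -map_poly_comp; apply: eq_map_poly => a /=.
by rewrite map_polyC /horner_eval hornerC.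
Qed.

(** [E] is a tower of simple extensions; each step multiplies the spanning family by powers of the
    new root, since division by [P] bounds the exponents. *)
Lemma finite_span_extension (B L : fieldType) (f : {rmorphism B -> L}) (s : seq L) :
  (forall z, z \in s -> exists2 R : {poly B}, R != 0 & (map_poly f R).[z] = 0) ->
  exists (E : fieldType) (g : {rmorphism E -> L}) (j : {rmorphism B -> E})
      (I : finType) (t : I -> E),
    [/\ forall b, g (j b) = f b,
        forall z, z \in s -> exists y, g y = z &
        forall y, exists c : I -> B, y = \sum_i j (c i) * t i].
Proof.
elim: s => [_|z s IH alg].
  exists B, f, idfun, 'I_1, (fun=> 1); split=> // y.
  by exists (fun=> y); rewrite big_ord1 mulr1.
have [|E [g [j [I [t [gj gs sp]]]]]] := IH.
  by move=> y ys; apply: alg; rewrite inE ys orbT.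
have [R R0 Rz] := alg z (mem_head _ _).
pose P := map_poly j R.
have P0 : P != 0 by rewrite map_poly_eq0.
have Pz : root (map_poly g P) z.
  apply/eqP; rewrite -[RHS]Rz /P -map_poly_comp; congr _.[_].
  by apply: eq_map_poly => b /=.
pose E' : fieldType := subFExtend g z P.
pose g' : {rmorphism E' -> L} := @subfx_inj _ _ g z P.
pose h : {rmorphism E -> E'} := @inj_subfx _ _ g z P.
pose w : E' := subfx_root g z P.
have g'h y : g' (h y) = g y.
  by rewrite /g' /h /= subfx_inj_eval // map_polyC hornerC.
have g'w : g' w = z by apply: subfx_inj_root.
pose j' : {rmorphism B -> E'} := h \o j.
exists E', g', j', (I * 'I_(size P))%type,
  (fun k : I * 'I_(size P) => h (t k.1) * w ^+ k.2).
split=> [b|y|y].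
- by rewrite /j' /= g'h gj.
- rewrite inE => /orP[/eqP->|/gs[y' <-]]; first by exists w.
  by exists (h y').
have [Q ->] := subfxE y.
have [c Hc] : exists c : 'I_(size P) -> I -> B, forall k : 'I_(size P),
    (Q %% P)`_k = \sum_i j (c k i) * t i.
  by have [c Hc] := choice (fun k : 'I_(size P) => sp (Q %% P)`_k); exists c.
exists (fun k : I * 'I_(size P) => c k.2 k.1).
have -> : subfx_eval g z P Q = \sum_(k < size P) h (Q %% P)`_k * w ^+ k :> E'.
  apply: (fmorph_inj g'); rewrite {1}/g' /= subfx_inj_eval //.
  rewrite {1}(divp_eq Q P) rmorphD rmorphM hornerD hornerM (eqP Pz) mulr0 add0r.
  rewrite (@horner_coef_wide _ (size P)); last first.
    by rewrite size_map_poly ltnW // ltn_modp.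
  rewrite rmorph_sum; apply: eq_bigr => k _.
  by rewrite rmorphM rmorphXn g'h g'w coef_map.
transitivity (\sum_(k < size P) \sum_i j' (c k i) * (h (t i) * w ^+ k)).
  apply: eq_bigr => k _; rewrite Hc rmorph_sum big_distrl.
  by apply: eq_bigr => i _; rewrite rmorphM mulrA.
by rewrite exchange_big pair_big.
Qed.

(** Raising a relation for [y] to the power [p ^ k] gives a relation for [x] whose coefficients are
    the powers of the old ones. *)
Lemma transcendental_pth_root (A : idomainType) (L : fieldType) p
    (charL : p \in [pchar L]) (i : {rmorphism A -> L}) (x y : L) k :
  transcendental i x -> y ^+ (p ^ k) = x -> transcendental i y.
Proof.
move=> tr yx P P0; apply/eqP => Py.
pose Q := \poly_(n < size P) P`_n ^+ (p ^ k).
have Q0 : Q != 0.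
  apply/eqP => /polyP/(_ (size P).-1)/eqP.
  rewrite coef_poly prednK ?size_poly_gt0 // leqnn coef0 expf_eq0.
  by rewrite -lead_coefE lead_coef_eq0 (negPf P0) andbF.
case/eqP: (tr Q Q0).
rewrite (@horner_coef_wide _ (size P)); last first.
  by apply: leq_trans (size_poly _ _) _; apply: size_poly.
transitivity ((map_poly i P).[y] ^+ (p ^ k)); last first.
  by rewrite Py expr0n gtn_eqF // expn_gt0 prime_gt0 // (pcharf_prime charL).
rewrite (@horner_coef_wide _ (size P) (map_poly i P)); last exact: size_poly.
rewrite (sum_expr_pchar_pow charL); apply: eq_bigr => n _.
by rewrite !coef_map coef_poly ltn_ord /= rmorphXn exprMn -yx -!exprM mulnC.
Qed.

Lemma common_denominator (A : idomainType) n (u : 'I_n -> {fraction A}) :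
  exists (D : A) (v : 'I_n -> A), D != 0 /\ forall k, u k * D%:F = (v k)%:F.
Proof.
have [a Ha] := choice (fun k => fractionP (u k)).
have [b Hb] := choice Ha.
exists (\prod_k b k), (fun k => a k * \prod_(l | l != k) b l); split.
  by apply/prodf_neq0 => k _; case: (Hb k).
move=> k; have [b0 ->] := Hb k; rewrite (bigD1 k) //= !rmorphM /= mulrA.
by rewrite divfK // tofrac_eq0.
Qed.

Lemma finitely_generated_subfield (L : fieldType) p (charL : p \in [pchar L])
    (x : L) (s : seq L) : x != 0 -> nontorsion x ->
  exists (E : fieldType) (g : {rmorphism E -> L}) (k : nat),
    (forall z, z \in s -> exists y, g y = z) /\ forall y, g y ^+ (p ^ k) != x.
Proof.
move=> x0 nrx.
have [A [i [tr alg]]] := transcendence_base charL s x0 nrx.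
pose ev : {rmorphism {poly A} -> L} := horner_eval x \o map_poly i.
have inj_ev : injective ev.
  by apply: raddf_inj => P; apply: contra_eq => /tr.
have [f fE] := fraction_lift inj_ev.
have [|E [g [j [I [t [gj gs sp]]]]]] := @finite_span_extension _ _ f s.
  move=> z /alg[R R0 Rz]; exists (map_poly (@FracField.tofrac _) R).
    rewrite -(map_poly0 (@FracField.tofrac _)).
    apply: contra R0 => /eqP/map_inj_poly e; apply/eqP/e; last exact: rmorph0.
    by apply: raddf_inj => P /eqP; rewrite tofrac_eq0 => /eqP.
  rewrite -[RHS]Rz horner2_map_eval -!map_poly_comp.
  by congr _.[_]; apply: eq_map_poly => P /=.
have p1 := prime_gt1 (pcharf_prime charL).
(* The exponent [#|I|] suffices because [p ^ #|I|] exceeds [#|I|], so the first [q] powers of a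
   [q]-th root [y] of [x] are linearly dependent over the fractions of A[x]. *)
exists E, g, #|I|; split=> // y; apply/eqP => yx.
set q := (p ^ #|I|)%N in yx.
have Iq : (#|I| < q)%N by apply: ltn_expl.
have [c Hc] := choice (fun k : 'I_q => sp (y ^+ k)).
pose C := \matrix_(k < q, l < #|I|) c k (enum_val l).
have /rowV0Pn[u /sub_kermxP uC u0] : kermx C != 0.
  rewrite kermx_eq0 /row_free; apply: contraL Iq => /eqP rC.
  by rewrite -leqNgt -[q in (q <= _)%N]rC; apply: rank_leq_col.
have yu : \sum_k j (u 0 k) * y ^+ k = 0.
  under eq_bigr => k _ do rewrite Hc big_distrr /=.
  rewrite exchange_big big1 // => l _ /=.
  transitivity (j ((u *m C) 0 (enum_rank l)) * t l); last first.
    by rewrite uC mxE rmorph0 mul0r.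
  rewrite mxE rmorph_sum big_distrl; apply: eq_bigr => k _ /=.
  by rewrite rmorphM mxE enum_rankK mulrA.
have [D [v [D0 vE]]] := common_denominator (u 0).
(* With denominators cleared and [x] replaced by [y ^+ q], the dependence becomes a polynomial
   relation for [y] over [A]. The summands have exponents in distinct classes modulo [q], so nothing
   cancels and [H] is nonzero. *)
pose H := \sum_(k < q) (v k \Po 'X^q) * 'X^k.
have q_gt0 : (0 < q)%N by apply: leq_ltn_trans Iq.
have H0 : H != 0.
  have /rV0Pn[k uk] := u0.
  have vk : v k != 0.
    by rewrite -tofrac_eq0 -vE; apply: mulf_neq0 uk _; rewrite tofrac_eq0.
  have /negP nl : lead_coef (v k) != 0 by rewrite lead_coef_eq0.
  apply/eqP => /polyP/(_ ((size (v k)).-1 * q + k)%N); rewrite coef0.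
  rewrite coef_sum (bigD1 k) //= big1 => [|l lk].
    rewrite addr0 coefMXn ltnNge leq_addl /= addnK coef_comp_poly_Xn //.
    by rewrite dvdn_mull // mulnK // => /eqP; rewrite -lead_coefE.
  rewrite coefMXn; case: ltnP => // le_l.
  rewrite coef_comp_poly_Xn // ifN //.
  rewrite -eqn_mod_dvd // modnMDl !modn_small //.
  by rewrite eq_sym.
have /eqP[] := transcendental_pth_root charL tr yx H0.
transitivity (ev D * g (\sum_k j (u 0 k) * y ^+ k)); last first.
  by rewrite yu rmorph0 mulr0.
rewrite /H !rmorph_sum horner_sum big_distrr.
apply: eq_bigr => k _; rewrite /= !rmorphM /= map_polyXn hornerM hornerXn.
rewrite rmorphXn gj mulrA -[horner_eval x _]/(ev D) -fE -rmorphM.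
rewrite [RHS]mulrC [_ * u 0 k]mulrC vE fE mulrC; congr (_ * _).
by rewrite map_comp_poly horner_comp map_polyXn hornerXn yx.
Qed.

(** * Power sums with values in a finitely generated group *)

(** Two surviving terms [x], [y] contradict [base_ratio_pth_power] in a subfield containing all the
    data, where [x / y] lacks a [p ^ k]-th root for some [k]. *)
Lemma power_sum_in_fg_group (L : fieldType) p (charL : p \in [pchar L])
    n (s : 'I_n -> L) (T : seq L) (c : L -> L) :
  (forall i, s i != 0) -> uniq T -> 0 \notin T ->
  {in T &, forall x y, x != y -> nontorsion (x / y)} ->
  (forall m, let u := \sum_(t <- T) c t * t ^+ m in
    u = 0 \/ exists z : 'I_n -> int, u = \prod_i s i ^ z i) ->
  {in T &, forall x y, x != y -> c x = 0 \/ c y = 0}.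
Proof.
move=> s0 uT T0 Tnr Hu x y xT yT xy.
have [cx0|cx0] := eqVneq (c x) 0; first by left.
have [cy0|cy0] := eqVneq (c y) 0; first by right.
have nz t : t \in T -> t != 0 by apply: contraTneq => ->.
(* Terms with zero coefficient are dropped, as [base_ratio_pth_power] needs every coefficient
   nonzero. *)
pose T' := [seq t <- T | c t != 0].
have T'T t : t \in T' -> t \in T by rewrite mem_filter => /andP[].
have [||E [g [k [gs nE]]]] := @finitely_generated_subfield _ _ charL (x / y)
    (T' ++ map c T' ++ codom s).
- by rewrite mulf_neq0 ?invr_eq0 ?nz.
- exact: Tnr.
pose r := size T'.
have T'i (i : 'I_r) : T'`_i \in T' by apply: mem_nth.
have [d dE] : {d : 'I_r -> E & forall i, g (d i) = T'`_i}.
  apply: (choice (P := fun (i : 'I_r) e => g e = T'`_i)) => i.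
  by apply: gs; rewrite mem_cat T'i.
have [e eE] : {e : 'I_r -> E & forall i, g (e i) = c T'`_i}.
  apply: (choice (P := fun (i : 'I_r) e => g e = c T'`_i)) => i.
  by apply: gs; rewrite !mem_cat map_f ?orbT.
have [w wE] : {w : 'I_n -> E & forall i, g (w i) = s i}.
  apply: (choice (P := fun i e => g e = s i)) => i.
  by apply: gs; rewrite !mem_cat codom_f !orbT.
have g0 z : (g z == 0) = (z == 0) by apply: fmorph_eq0.
have uE m : g (\sum_i e i * d i ^+ m) = \sum_(t <- T) c t * t ^+ m.
  rewrite rmorph_sum [RHS](bigID (fun t => c t == 0)) /=.
  rewrite [X in X + _]big1 => [|t /eqP->]; last by rewrite mul0r.
  rewrite add0r -[RHS]big_filter -/T' [RHS](big_nth 0) big_mkord.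
  by apply: eq_bigr => i _; rewrite rmorphM rmorphXn eE dE.
have [i xE] : exists i : 'I_r, x = T'`_i.
  have xT' : x \in T' by rewrite mem_filter cx0.
  have ix : (index x T' < r)%N by rewrite index_mem.
  by exists (Ordinal ix); rewrite nth_index.
have [j yE] : exists i : 'I_r, y = T'`_i.
  have yT' : y \in T' by rewrite mem_filter cy0.
  have iy : (index y T' < r)%N by rewrite index_mem.
  by exists (Ordinal iy); rewrite nth_index.
have charE : p \in [pchar E] by rewrite -(fmorph_pchar g).
have [|||||z ij] := @base_ratio_pth_power E p charE r e d n w _ _ _ _ _ k i j.
- by move=> l; rewrite -g0 eE; have := T'i l; rewrite mem_filter => /andP[].
- by move=> l; rewrite -g0 dE nz // T'T.
- move=> l h lh m; rewrite -(inj_eq (fmorph_inj g)) rmorphXn rmorph1 fmorph_div !dE.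
  by apply: Tnr; rewrite ?T'T // nth_uniq ?filter_uniq.
- by move=> l; rewrite -g0 wE.
- move=> m u; case: (Hu m) => [um|[z um]]; [left|right].
    by apply/eqP; rewrite -g0 uE um.
  exists z; apply: (fmorph_inj g); rewrite uE um rmorph_prod.
  by apply: eq_bigr => l _; rewrite -wE fmorphXz.
by have /eqP[] := nE z; rewrite -rmorphXn -ij fmorph_div !dE -xE -yE.
Qed.

Lemma power_sum_in_fg_group_geometric (L : fieldType) p (charL : p \in [pchar L])
    n (s : 'I_n -> L) (T : seq L) (c : L -> L) (u : nat -> L) :
  (forall i, s i != 0) -> uniq T -> 0 \notin T ->
  {in T &, forall x y, x != y -> nontorsion (x / y)} ->
  (forall m, u m = \sum_(t <- T) c t * t ^+ m) ->
  (forall m, u m = 0 \/ exists z : 'I_n -> int, u m = \prod_i s i ^ z i) ->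
  exists2 d, d != 0 & forall m, u m.+1 = d * u m.
Proof.
move=> s0 uT T0 Tnr uE Hu.
have H : {in T &, forall x y, x != y -> c x = 0 \/ c y = 0}.
  by apply: (power_sum_in_fg_group charL s0 uT T0 Tnr) => m; rewrite /= -uE.
have [[x xT cx]|nx] := pselect (exists2 x, x \in T & c x != 0).
  exists x; first by apply: contraNneq T0 => <-.
  have {}uE m : u m = c x * x ^+ m.
    rewrite uE (bigD1_seq x) //= big_seq_cond big1 ?addr0 // => y /andP[yT yx].
    have [|cx0|->] := H x y xT yT; first by rewrite eq_sym.
      by rewrite cx0 eqxx in cx.
    by rewrite mul0r.
  by move=> m; rewrite !uE exprS mulrCA.
exists 1; first exact: oner_neq0.
have {}uE m : u m = 0.
  rewrite uE big_seq big1 // => x xT.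
  have [->|cx] := eqVneq (c x) 0; first by rewrite mul0r.
  by case: nx; exists x.
by move=> m; rewrite !uE mulr0.
Qed.

(** * Linear recurrences *)

(** The K[X]-module structure on sequences in which ['X] acts as the shift; [P] kills [u] exactly
    when [u] satisfies the recurrence with characteristic polynomial [P]. *)
Definition shift_act (K : fieldType) (P : {poly K}) (u : nat -> K) (n : nat) : K :=
  \sum_(i < size P) P`_i * u (n + i)%N.

Section ShiftAct.
Variable K : fieldType.
Implicit Types (P Q : {poly K}) (u : nat -> K) (n : nat).

Lemma shift_act_wide m P u n : (size P <= m)%N ->
  shift_act P u n = \sum_(i < m) P`_i * u (n + i)%N.
Proof.
move=> le_m; rewrite /shift_act (big_ord_widen _ (fun i => P`_i * u (n + i)%N) le_m).
rewrite big_mkcond; apply: eq_bigr => i _.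
by case: ltnP => // le_i; rewrite nth_default ?mul0r.
Qed.

Lemma shift_actD P Q u n :
  shift_act (P + Q) u n = shift_act P u n + shift_act Q u n.
Proof.
set m := maxn (size P) (size Q).
rewrite !(@shift_act_wide m) ?leq_maxl ?leq_maxr ?size_polyD // -big_split.
by apply: eq_bigr => i _; rewrite coefD mulrDl.
Qed.

Lemma shift_actC (c : K) u n : shift_act c%:P u n = c * u n.
Proof.
rewrite (@shift_act_wide 1) ?size_polyC_leq1 // big_ord1.
by rewrite coefC addn0.
Qed.

Lemma shift_act0 u n : shift_act 0 u n = 0.
Proof. by rewrite -polyC0 shift_actC mul0r. Qed.

Lemma shift_actMX P u n : shift_act (P * 'X) u n = shift_act P u n.+1.
Proof.
rewrite (@shift_act_wide (size P).+1); last first.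
  have [->|P0] := eqVneq P 0; first by rewrite mul0r size_poly0.
  by rewrite size_mulX.
rewrite big_ord_recl coefMX eqxx mul0r add0r.
by apply: eq_bigr => i _; rewrite coefMX /= addnS.
Qed.

Lemma shift_actMXn P u m n : shift_act (P * 'X^m) u n = shift_act P u (n + m).
Proof.
elim: m n => [|m IH] n; first by rewrite mulr1 addn0.
by rewrite exprSr mulrA shift_actMX IH addSnnS.
Qed.

Lemma shift_act_eq P u v n : u =1 v -> shift_act P u n = shift_act P v n.
Proof. by move=> uv; apply: eq_bigr => i _; rewrite uv. Qed.

Lemma shift_actZ (c : K) Q u n : shift_act (c%:P * Q) u n = c * shift_act Q u n.
Proof.
rewrite (@shift_act_wide (size Q)); last by rewrite mul_polyC size_scale_leq.
by rewrite /shift_act big_distrr; apply: eq_bigr => i _; rewrite /= coefCM mulrA.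
Qed.

Lemma shift_actM P Q u n :
  shift_act (P * Q) u n = shift_act P (shift_act Q u) n.
Proof.
elim/poly_ind: P n => [|P c IH] n; first by rewrite mul0r !shift_act0.
rewrite mulrDl mulrAC !shift_actD !shift_actMX IH shift_actC.
by rewrite shift_actZ.
Qed.

Lemma shift_act_comp_Xn P u M b n : shift_act (P \Po 'X^M) u (b + M * n) =
  shift_act P (fun k => u (b + M * k)%N) n.
Proof.
elim/poly_ind: P n => [|P c IH] n; first by rewrite comp_poly0 !shift_act0.
rewrite comp_polyD comp_polyM comp_polyX comp_polyC !shift_actD !shift_actC.
by rewrite shift_actMXn shift_actMX -addnA -mulnSr IH.
Qed.

Lemma shift_act_dvd P Q u : P %| Q -> (forall n, shift_act P u n = 0) ->
  forall n, shift_act Q u n = 0.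
Proof.
move=> /dvdpP[R ->] Pu n; rewrite shift_actM; apply: big1 => i _.
by rewrite Pu mulr0.
Qed.

Lemma recurrence_power_sum (T : seq K) u : uniq T ->
  (forall n, shift_act (\prod_(t <- T) ('X - t%:P)) u n = 0) ->
  exists c : K -> K, forall n, u n = \sum_(t <- T) c t * t ^+ n.
Proof.
elim: T u => [|x T IH] u /=.
  move=> _ Hu; exists (fun=> 0) => n; rewrite big_nil.
  by have := Hu n; rewrite big_nil -polyC1 shift_actC mul1r.
move=> /andP[xT uT] Hu.
have act1 v n : shift_act ('X - x%:P) v n = v n.+1 - x * v n.
  rewrite -polyCN shift_actD -['X]mul1r shift_actMX -polyC1.
  by rewrite !shift_actC mul1r mulNr.
have [|c Hc] := IH (shift_act ('X - x%:P) u) uT.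
  by move=> n; have := Hu n; rewrite big_cons mulrC shift_actM.
(* The subtracted sum is a particular solution of the equation left by ['X - x%:P]; the difference
   is geometric of ratio [x]. *)
pose w n := u n - \sum_(t <- T) c t / (t - x) * t ^+ n.
have wS n : w n.+1 = x * w n.
  have := Hc n; rewrite act1 /w.
  have -> : \sum_(t <- T) c t * t ^+ n = \sum_(t <- T) c t / (t - x) * t ^+ n.+1
      - x * \sum_(t <- T) c t / (t - x) * t ^+ n.
    rewrite big_distrr -sumrB; apply: eq_big_seq => t tT /=.
    have tx : t - x != 0 by rewrite subr_eq0; apply: contraNneq xT => <-.
    by rewrite exprS; field.
  by move=> /eqP; rewrite subr_eq => /eqP->; ring.
exists (fun t => if t == x then w 0%N else c t / (t - x)) => n.
rewrite big_cons eqxx.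
have -> : w 0%N * x ^+ n = w n.
  by elim: n => [|n IHn]; rewrite ?mulr1 // wS -IHn exprS mulrCA.
rewrite /w -[LHS](subrK (\sum_(t <- T) c t / (t - x) * t ^+ n)); congr +%R.
apply: eq_big_seq => t tT; rewrite ifN //.
by apply: contraNneq xT => <-.
Qed.

End ShiftAct.

(** * Removing torsion ratios and multiple roots *)

Lemma nontorsionX (L : fieldType) (x : L) n :
  (0 < n)%N -> nontorsion x -> nontorsion (x ^+ n).
Proof. by case: n => // n _ nrx m; rewrite -exprM mulSn addSn. Qed.

Lemma nondegenerate_exponent (L : fieldType) (s : seq L) : 0 \notin s ->
  exists2 M, (0 < M)%N & {in s &, forall x y,
    nontorsion (x ^+ M / y ^+ M) \/ x ^+ M = y ^+ M}.
Proof.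
move=> s0.
have [f Hf] : {f : L -> nat & forall z,
  (0 < f z)%N /\ (nontorsion z \/ z ^+ f z = 1)}.
  apply: (choice (P := fun z n => (0 < n)%N /\ (nontorsion z \/ z ^+ n = 1))) => z.
  have [nrz|] := pselect (nontorsion z); first by exists 1%N; split=> //; left.
  by move=> /existsNP[n /negP/negPn/eqP zn]; exists n.+1; split=> //; right.
(* A common multiple of exponents killing all the torsion ratios. *)
exists (\prod_(x <- s) \prod_(y <- s) f (x / y))%N.
  apply/prodn_cond_gt0 => x _; apply/prodn_cond_gt0 => y _.
  by have [] := Hf (x / y).
set M := (\prod_(_ <- _) _)%N => x y xs ys.
have y0 : y != 0 by apply: contraNneq s0 => <-.
have M0 : (0 < M)%N.
  apply/prodn_cond_gt0 => z _; apply/prodn_cond_gt0 => t _.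
  by have [] := Hf (z / t).
have [_ [nr|e]] := Hf (x / y).
  by left; rewrite -expr_div_n; apply: nontorsionX.
right; have /dvdnP[k Mk] : (f (x / y) %| M)%N.
  by rewrite /M (big_rem x xs) (big_rem y ys) /= -mulnA dvdn_mulr.
apply: (mulIf (x := (y ^+ M)^-1)); first by rewrite invr_eq0 expf_neq0.
by rewrite divff ?expf_neq0 // -expr_div_n Mk mulnC exprM e expr1n.
Qed.

(** The exponent [m] identifies roots that differ by torsion. Multiplicities are absorbed by [q], a
    power of the characteristic larger than [size s], since the [q]-th power of ['X^m - t%:P] is
    ['X^(m * q) - (t ^+ q)%:P]. *)
Lemma nondegenerate_multiple (L : fieldType) p (charL : p \in [pchar L]) (s : seq L) :
  0 \notin s -> exists M (T : seq L),
    [/\ (0 < M)%N, uniq T, 0 \notin T,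
        {in T &, forall x y, x != y -> nontorsion (x / y)} &
        \prod_(r <- s) ('X - r%:P) %| \prod_(t <- T) ('X^M - t%:P)].
Proof.
move=> s0; have [m m0 Hm] := nondegenerate_exponent s0.
have p1 := prime_gt1 (pcharf_prime charL).
pose q := (p ^ size s)%N.
have q0 : (0 < q)%N by rewrite expn_gt0 ltnW.
pose T0 := undup [seq r ^+ m | r <- s].
have T0nr : {in T0 &, forall x y, x != y -> nontorsion (x / y)}.
  move=> x y; rewrite !mem_undup => /mapP[r rs ->] /mapP[r' rs' ->] /eqP.
  by case: (Hm r r' rs rs').
have T00 t : t \in T0 -> t != 0.
  rewrite mem_undup => /mapP[r rs ->]; apply: expf_neq0.
  by apply: contraNneq s0 => <-.
exists (m * q)%N, [seq t ^+ q | t <- T0]; split.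
- by rewrite muln_gt0 m0.
- rewrite map_inj_in_uniq ?undup_uniq // => x y xT yT xy.
  apply: contrapT => /eqP nxy; have := T0nr x y xT yT nxy q.-1.
  by rewrite prednK // expr_div_n xy divff ?eqxx // expf_neq0 ?T00.
- apply/mapP => -[t /T00 t0 /esym/eqP]; rewrite expf_eq0 (negPf t0) andbF //.
- move=> _ _ /mapP[x xT ->] /mapP[y yT ->] xy; rewrite -expr_div_n.
  by apply: nontorsionX => //; apply: T0nr => //; apply: contraNneq xy => ->.
pose D := \prod_(t <- T0) ('X^m - t%:P).
have -> : \prod_(t <- [seq t ^+ q | t <- T0]) ('X^(m * q) - t%:P) = D ^+ q.
  rewrite big_map -prodrXl; apply: eq_bigr => t _.
  have charP : p \in [pchar {poly L}] by rewrite pchar_poly.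
  have := exprD_pchar_pow charP (size s) ('X^m - t%:P) t%:P.
  by rewrite subrK -exprM -polyC_exp => ->; rewrite addrK.
apply: (@dvdp_trans _ (D ^+ size s)); last first.
  by apply: dvdp_exp2l; rewrite ltnW // ltn_expl.
have rD r : r \in s -> 'X - r%:P %| D.
  move=> rs; rewrite dvdp_XsubCl /root /D horner_prod prodf_seq_eq0.
  apply/hasP; exists (r ^+ m); first by rewrite mem_undup; apply/mapP; exists r.
  by rewrite !hornerE subrr.
have {rD}: forall s', {subset s' <= s} -> \prod_(r <- s') ('X - r%:P) %| D ^+ size s'.
  elim=> [|r s' IH] ss; first by rewrite big_nil dvd1p.
  rewrite big_cons exprS dvdp_mul ?rD ?ss ?mem_head // IH // => t ts.
  by rewrite ss // inE ts orbT.
exact.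
Qed.

(** * Splitting fields *)

Lemma irreducible_factor (K : fieldType) (P : {poly K}) : (1 < size P)%N ->
  exists2 Q, irreducible_poly Q & Q %| P.
Proof.
move=> P1.
pose S n := `[< exists Q : {poly K}, [/\ (1 < size Q)%N, Q %| P & size Q = n] >].
have exS : exists n, S n by exists (size P); apply/asboolP; exists P.
case: (ex_minnP exS) => n /asboolP[Q [Q1 QP <-]] Qmin; exists Q => //.
split=> // R R1 RQ.
have R0 : R != 0.
  by apply: contraTneq RQ => ->; rewrite dvd0p -size_poly_gt0 (ltnW Q1).
rewrite -dvdp_size_eqp // eqn_leq dvdp_leq -?size_poly_gt0 ?(ltnW Q1) //=.
apply: Qmin; apply/asboolP; exists R; split=> //; last exact: dvdp_trans RQ QP.
by rewrite ltn_neqAle eq_sym R1 size_poly_gt0.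
Qed.

Lemma splitting_extension (K : fieldType) (P : {poly K}) : P != 0 ->
  exists (L : fieldType) (i : {rmorphism K -> L}) (s : seq L),
    map_poly i P %= \prod_(r <- s) ('X - r%:P).
Proof.
have [n] := ubnP (size P); elim: n K P => // n IH K P /ltnSE sP P0.
have [P1|P1] := leqP (size P) 1%N.
  exists K, idfun, [::]; rewrite big_nil map_poly_id //.
  by rewrite -size_poly_eq1 eqn_leq P1 size_poly_gt0.
have [Q Qirr QP] := irreducible_factor P1.
have [L _ [z Qz _]] := irredp_FAdjoin Qirr.
have : root (map_poly (in_alg L) P) z.
  by apply: root_dvdp Qz; rewrite dvdp_map.
rewrite -dvdp_XsubCl => /dvdpP[R PR].
have R0 : R != 0.
  apply: contra_neq P0 => R0; apply/eqP.
  by rewrite -(map_poly_eq0 (in_alg L)) PR R0 mul0r.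
have [|L' [i [s Rs]]] := IH L R _ R0.
  have := congr1 (fun p : {poly L} => size p) PR.
  rewrite size_map_poly size_mul ?polyXsubC_eq0 // size_XsubC addn2 /= => <-.
  exact: sP.
exists L', (i \o in_alg L), (i z :: s).
rewrite map_poly_comp PR rmorphM /= rmorphB /= map_polyX map_polyC /=.
by rewrite big_cons mulrC eqp_mull.
Qed.

(** * From rational series to geometric residue classes *)

Lemma rational_series_recurrence (K : fieldType) (a : nat -> K) :
  rational_series a -> exists (C : {poly K}) s,
    C.[0] != 0 /\ forall n, shift_act C (fun k => a (s + k)%N) n = 0.
Proof.
move=> [_ [P [Q [Q0 _ Qa]]]].
have nzQ : Q != 0 by apply: contra_neq Q0 => ->; rewrite horner0.
pose d := (size Q).-1.
(* The reciprocal polynomial of [Q]: its value at 0 is the leading coefficient of [Q], so 0 is not a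
   root. Starting at [size P] passes the numerator. *)
exists (\poly_(j < d.+1) Q`_(d - j)), (size P); split=> [|n].
  by rewrite horner_coef0 coef_poly subn0 lead_coef_eq0.
rewrite (@shift_act_wide _ d.+1) ?size_poly //.
have := Qa (size P + n + d)%N; rewrite [RHS]nth_default; last first.
  by rewrite -addnA leq_addr.
set N := (size P + n + d)%N => QaN; rewrite -[RHS]QaN.
have le_d : (d.+1 <= N.+1)%N by rewrite ltnS leq_addl.
transitivity (\sum_(i < d.+1) Q`_i * a (N - i)%N).
  rewrite (reindex_inj rev_ord_inj); apply: eq_bigr => i _ /=.
  have le_i : (i <= d)%N by rewrite -ltnS.
  rewrite coef_poly subSS ltnS leq_subr subKn //; congr (_ * a _).
  by rewrite /N -addnBA // addnA.
rewrite (big_ord_widen _ (fun i => Q`_i * a (N - i)%N) le_d) big_mkcond.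
apply: eq_bigr => i _; case: ltnP => // le_i.
by rewrite nth_default ?mul0r // -[size Q]prednK // size_poly_gt0.
Qed.

Lemma fg_units_subgroup_prod (K : fieldType) (G : set K) : fg_units_subgroup G ->
  exists n (s : 'I_n -> K), (forall i, s i != 0) /\
    forall x, G x -> exists z : 'I_n -> int, x = \prod_i s i ^ z i.
Proof.
move=> [[G0 _ _] [s Gs]]; exists (size s), (fun i => s`_i).
have s0 (i : 'I_(size s)) : s`_i != 0.
  by apply: G0; rewrite Gs => X [_]; apply; apply: mem_nth.
split=> // x; rewrite {1}Gs.
(* Minimality of [G] is applied to the group of monomials in the generators. *)
move/(_ [set y | exists z : 'I_(size s) -> int,
  y = \prod_(i < size s) s`_i ^ z i]); apply.
split=> [|t /= ts]; last first.
  have it : (index t s < size s)%N by rewrite index_mem.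
  exists (fun i => (i == Ordinal it)%:R).
  rewrite (bigD1 (Ordinal it)) //= eqxx expr1z nth_index // big1 ?mulr1 // => i.
  by move/negPf->; rewrite expr0z.
split=> [y [z ->]||x1 x2 [z1 ->] [z2 ->]].
- by apply/prodf_neq0 => i _; rewrite expfz_neq0.
- by exists (fun=> 0); rewrite big1 // => i _; rewrite expr0z.
exists (fun i => z1 i - z2 i); rewrite -prodf_div.
by apply: eq_bigr => i _; rewrite expfzDr // -invr_expz.
Qed.

Lemma shift_act_map (K L : fieldType) (i : {rmorphism K -> L}) (P : {poly K}) u n :
  shift_act (map_poly i P) (fun k => i (u k)) n = i (shift_act P u n).
Proof.
rewrite /shift_act size_map_poly rmorph_sum.
by apply: eq_bigr => j _; rewrite coef_map rmorphM.
Qed.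

Lemma eventually_geometric (K : fieldType) p (charK : p \in [pchar K])
    (G : set K) (fgG : fg_units_subgroup G)
    (a : nat -> K) (rat_a : rational_series a)
    (aG : forall n, (G `|` [set 0]) (a n)) :
  exists M N, (0 < M)%N /\ forall b, exists2 d, G d &
    forall n, a (b + M * (N + n).+1)%N = d * a (b + M * (N + n))%N.
Proof.
have [[G0 G1 Gdiv] _] := fgG.
have [m [s [s0 sG]]] := fg_units_subgroup_prod fgG.
have [C [N [C0 CP]]] := rational_series_recurrence rat_a.
have nzC : C != 0 by apply: contra_neq C0 => ->; rewrite horner0.
have [L [i [rs Crs]]] := splitting_extension nzC.
have i0 x : (i x == 0) = (x == 0) by apply: fmorph_eq0.
have charL : p \in [pchar L] by rewrite (fmorph_pchar i).
have rs0 : 0 \notin rs.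
  rewrite -root_prod_XsubC -(eqp_root Crs) /root.
  by rewrite horner_coef0 coef_map i0 -horner_coef0.
have [M [T [M0 uT T0 Tnr MT]]] := nondegenerate_multiple charL rs0.
exists M, N; split=> // b.
pose u n := i (a (b + M * (N + n))%N).
have leN : (N <= M * N)%N by rewrite leq_pmull.
(* The recurrence holds from index [N] on. As [M * N] is at least [N], [u] is the residue class of
   [v] starting at [b + (M * N - N)], on which ['X^M] acts as a shift by one. *)
have act_u n : shift_act (\prod_(t <- T) ('X - t%:P)) u n = 0.
  pose v k := i (a (N + k)%N).
  have Cv k : shift_act (\prod_(t <- T) ('X^M - t%:P)) v k = 0.
    apply: (@shift_act_dvd _ (map_poly i C)) => [|l].
      by rewrite (eqp_dvdl _ Crs).
    by rewrite shift_act_map CP rmorph0.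
  have := Cv (b + (M * N - N) + M * n)%N.
  have -> : \prod_(t <- T) ('X^M - t%:P) = (\prod_(t <- T) ('X - t%:P)) \Po 'X^M.
    rewrite rmorph_prod; apply: eq_bigr => t _.
    by rewrite /= comp_polyB comp_polyX comp_polyC.
  rewrite shift_act_comp_Xn => <-; apply: shift_act_eq => k.
  congr (i (a _)); rewrite mulnDr !addnA; congr addn.
  by rewrite [(N + b)%N]addnC -addnA subnKC.
have [c uE] := recurrence_power_sum uT act_u.
have [||d d0 dE] := @power_sum_in_fg_group_geometric L p charL m (i \o s) T c u
  _ uT T0 Tnr uE.
- by move=> j /=; rewrite i0.
- move=> n; rewrite /u.
  case: (aG (b + M * (N + n))%N) => [/sG[z ->]|/= ->]; last first.
    by left; rewrite rmorph0.
  right; exists z; rewrite rmorph_prod; apply: eq_bigr => j _.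
  by rewrite fmorphXz.
(* The ratio [d] is only known in [L]. If the first term is zero, so are all, and the ratio 1
   serves; otherwise [d] is the image of a quotient of two elements of [G]. *)
have [a0|a0] := eqVneq (a (b + M * (N + 0))%N) 0.
  have u0 n : u n = 0.
    by elim: n => [|n IH]; rewrite ?dE ?IH ?mulr0 // /u a0 rmorph0.
  have {}u0 n : a (b + M * (N + n))%N = 0 by apply/eqP; rewrite -i0 [i _]u0.
  by exists 1 => // n; rewrite -addnS !u0 mulr0.
have nzG n : a n != 0 -> G (a n) by case: (aG n) => // /= ->; rewrite eqxx.
have dE0 : d = i (a (b + M * (N + 1))%N / a (b + M * (N + 0))%N).
  by rewrite fmorph_div -[i (a (b + M * (N + 1))%N)]/(u 1%N) dE mulfK // /u i0.
exists (a (b + M * (N + 1))%N / a (b + M * (N + 0))%N).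
  apply: Gdiv; apply: nzG => //.
  by rewrite -i0 -[i _]/(u 1%N) dE mulf_neq0 // /u i0.
move=> n; apply: (fmorph_inj i); rewrite rmorphM -dE0 -addnS.
exact: dE.
Qed.

(** * Expansions of rational functions *)

Section Expansion.
Variable K : fieldType.
Implicit Types (f g : {fraction {poly K}}) (a b : nat -> K) (P Q : {poly K}).

Lemma coefM_truncated Q a n m : (m <= n)%N ->
  (Q * \poly_(i < n.+1) a i)`_m = \sum_(i < m.+1) Q`_i * a (m - i)%N.
Proof.
move=> le_m; rewrite coefM; apply: eq_bigr => i _.
by rewrite coef_poly ltnS (leq_trans (leq_subr _ _) le_m).
Qed.

Lemma is_expansion_poly P : is_expansion P%:F (fun n => P`_n).
Proof.
exists P, 1; split=> [||n]; first by rewrite hornerC oner_neq0.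
  by rewrite tofrac1 divr1.
rewrite big_ord_recl coefC mul1r subn0 big1 ?addr0 // => i _.
by rewrite coefC mul0r.
Qed.

Lemma is_expansionD f g a b : is_expansion f a -> is_expansion g b ->
  is_expansion (f + g) (fun n => a n + b n).
Proof.
move=> [P [Q [Q0 -> Qa]]] [P' [Q' [Q0' -> Qb]]].
have nz (R : {poly K}) : R.[0] != 0 -> R%:F != 0.
  by rewrite tofrac_eq0; apply: contra_neq => ->; rewrite horner0.
exists (P * Q' + P' * Q), (Q * Q'); split=> [||n].
- by rewrite hornerM mulf_neq0.
- by rewrite addf_div ?nz // rmorphD !rmorphM.
(* Truncating the series above degree [n] turns Cauchy products into polynomial products without
   changing the coefficient of degree [n]. *)
have trM (R S : {poly K}) c (T : {poly K}) :
    (forall n, \sum_(i < n.+1) R`_i * c (n - i)%N = T`_n) ->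
    (S * (R * \poly_(i < n.+1) c i))`_n = (S * T)`_n.
  move=> RT; rewrite !coefM; apply: eq_bigr => i _.
  by rewrite coefM_truncated ?leq_subr // RT.
rewrite -(@coefM_truncated _ (fun n => a n + b n) n) //.
have -> : \poly_(i < n.+1) (a i + b i) =
    \poly_(i < n.+1) a i + \poly_(i < n.+1) b i.
  by apply/polyP => i; rewrite coefD !coef_poly; case: ifP; rewrite ?addr0.
rewrite mulrDr coefD {1}[Q * Q']mulrC -!mulrA (trM _ _ _ _ Qa).
by rewrite (trM _ _ _ _ Qb) [Q' * P]mulrC [Q * P']mulrC coefD.
Qed.

Lemma is_expansion_sum (I : Type) (s : seq I) (f : I -> {fraction {poly K}})
    (a : I -> nat -> K) :
  (forall i, is_expansion (f i) (a i)) ->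
  is_expansion (\sum_(i <- s) f i) (fun n => \sum_(i <- s) a i n).
Proof.
move=> fa; elim: s => [|i s IH].
  have := is_expansion_poly 0; rewrite tofrac0 big_nil; congr is_expansion.
  by apply: funext => n; rewrite big_nil coef0.
have := is_expansionD (fa i) IH; rewrite big_cons; congr is_expansion.
by apply: funext => n; rewrite big_cons.
Qed.

(** The hypothesis is the equation [(1 - d *: 'X^M) * a = c *: 'X^k] read on coefficients. *)
Lemma is_expansion_geometric (c d : K) k M a : (0 < M)%N ->
  (forall n, a n - (if (n < M)%N then 0 else d * a (n - M)%N) =
    if n == k then c else 0) ->
  is_expansion ((c *: 'X^k)%:F / (1 - d *: 'X^M)%:F) a.
Proof.
move=> M0 aE; exists (c *: 'X^k), (1 - d *: 'X^M); split=> [|//|n].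
  by rewrite !hornerE expr0n gtn_eqF // mulr0 subr0 oner_neq0.
rewrite -(@coefM_truncated _ _ n) // mulrBl mul1r -scalerAl coefB coefZ.
rewrite coefXnM !coef_poly ltnSn coefZ coefXn ltnS leq_subr.
have := aE n; case: ltnP => _; case: eqP => _; rewrite ?mulr0 ?mulr1; exact.
Qed.

End Expansion.

(** * Assembling the residue classes *)

Theorem theorem1p4 (K : fieldType) (p : nat) (charK : p \in [pchar K])
    (G : set K) (fgG : fg_units_subgroup G)
    (a : nat -> K) (rat_a : rational_series a)
    (aG : forall n, (G `|` [set 0]) (a n)) :
  exists (M N : nat) (P : {poly K}) (delta mu : 'I_M -> K),
    [/\ (1 <= M)%N,
        (size P <= M * N)%N /\ (forall n, (G `|` [set 0]) P`_n),
        forall b, G (delta b),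
        forall b, (G `|` [set 0]) (mu b) &
        is_expansion
          (P%:F + \sum_(b < M)
             (mu b *: 'X^(b + M * N))%:F / (1 - delta b *: 'X^M)%:F)
          a].
Proof.
have [M [N [M0 geo]]] := eventually_geometric charK fgG rat_a aG.
have [d dE] : {d : nat -> K & forall b, G (d b) /\ forall n,
    a (b + M * (N + n).+1)%N = d b * a (b + M * (N + n))%N}.
  apply: (choice (P := fun b d => G d /\ forall n,
    a (b + M * (N + n).+1)%N = d * a (b + M * (N + n))%N)) => b.
  by have [d Gd dE] := geo b; exists d.
exists M, N, (\poly_(i < M * N) a i), (fun b : 'I_M => d b),
  (fun b : 'I_M => a (b + M * N)%N).
split=> // [|b|].
- split=> [|n]; first exact: size_poly.
  by rewrite coef_poly; case: ifP => // _; right.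
- by have [] := dE b.
(* The part of [a] in the class of [b] from index [M * N] on; its first term, at [b + M * N], is the
   numerator coefficient. *)
pose h (b : 'I_M) n := if (M * N <= n)%N && (n %% M == b)%N then a n else 0.
have hE (b : 'I_M) : is_expansion
    ((a (b + M * N)%N *: 'X^(b + M * N))%:F / (1 - d b *: 'X^M)%:F) (h b).
  apply: is_expansion_geometric => // n; rewrite /h.
  have bM : (b %% M = b)%N by rewrite modn_small.
  have kE l : ((b + M * l) %% M = b)%N by rewrite mulnC addnC modnMDl.
  have [nb|nb] := eqVneq (n %% M)%N (b : nat); last first.
    have /negPf-> : n != (b + M * N)%N by apply: contraNneq nb => ->; rewrite kE.
    rewrite andbF.
    case: ltnP => [|le_M]; first by rewrite subr0.
    by rewrite -(modnDr (n - M)) subnK // (negPf nb) andbF mulr0 subr0.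
  rewrite andbT (divn_eq n M) nb addnC [(_ * M)%N]mulnC.
  set m := (n %/ M)%N.
  have leE l : (M * N <= b + M * l)%N = (N <= l)%N.
    apply/idP/idP => [le_MN|le_Nl].
      rewrite -ltnS -(ltn_pmul2l M0) (leq_ltn_trans le_MN) // mulnS ltn_add2r.
      exact: ltn_ord.
    by rewrite (leq_trans _ (leq_addl _ _)) // leq_mul2l le_Nl orbT.
  rewrite leE eqn_add2l eqn_pmul2l //; case: m => [|m].
    rewrite muln0 addn0 ltn_ord subr0 leqn0 eq_sym.
    by case: eqP => [<-|//]; rewrite muln0 addn0.
  have -> : (b + M * m.+1 < M)%N = false by rewrite ltnNge mulnS addnCA leq_addr.
  have -> : (b + M * m.+1 - M = b + M * m)%N by rewrite mulnS addnCA addKn.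
  rewrite leE kE eqxx andbT.
  (* At index [b + M * m.+1]: past the first term the geometric relation applies, before it both
     values vanish, and at it the previous value is 0 and the numerator appears. *)
  case: (ltngtP N m.+1) => [/ltnSE le_Nm|lt_mN|eN].
  - rewrite le_Nm; have [_ /(_ (m - N)%N)] := dE b.
    by rewrite subnKC // => ->; rewrite subrr.
  - by rewrite leqNgt ltnW // mulr0 subr0.
  - by rewrite eN ltnn mulr0 subr0.
have := is_expansionD (is_expansion_poly (\poly_(i < M * N) a i))
  (is_expansion_sum (index_enum _) hE).
congr is_expansion; apply: funext => n; rewrite coef_poly.
case: ltnP => le_n.
  by rewrite big1 ?addr0 // => b _; rewrite /h leqNgt le_n.
rewrite add0r (bigD1 (Ordinal (ltn_pmod n M0))) //= /h le_n eqxx big1 ?addr0 //.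
by move=> b bn; rewrite ifN //; apply: contra bn => /eqP e; apply/eqP/val_inj.
Qed.
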